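(* Let $L$ be an invariant $r\times m$ integer matrix of full rank $r$. Then for every $\alpha>0$ there exists $c=c(\alpha,L)>0$ such that every measurable set $A\subset\mathbb{T}$ with $\mu_{\mathbb{T}}(A)\ge\alpha$ satisfies $S_L(A)\ge c$.
   Context: $\mathbb{T}=\mathbb{R}/\mathbb{Z}$ with normalized Haar (Lebesgue) measure $\mu_{\mathbb{T}}$; ''measurable'' means Borel measurable. An integer matrix $L$ is invariant if $L\mathbf{1}=0$ where $\mathbf{1}=(1,\ldots,1)$. $\ker_{\mathbb{T}}L=\{x\in\mathbb{T}^m:Lx=0\}$ with normalized Haar probability measure $\mu_L$, and $S_L(A)=\mu_L\big(A^m\cap\ker_{\mathbb{T}}L\big)$. *)

(* Defs.v *)
From HB Require Import structures.
From mathcomp Require Import all_boot all_order all_algebra.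
From mathcomp Require Import all_classical all_reals all_analysis.
Set Implicit Arguments. Unset Strict Implicit. Unset Printing Implicit Defensive.
Import Order.TTheory GRing.Theory Num.Theory.
Local Open Scope classical_set_scope.
Local Open Scope ring_scope.

(* The torus T = R/Z is represented by its fundamental domain [0,1[ ;
   a point of T^m is an m-tuple of reals, its canonical representative
   lying in [0,1[^m. *)

Definition frac {R : realType} (x : R) : R := x - (Num.floor x)%:~R.

Definition addT {R : realType} {m : nat} (x y : m.-tuple R) : m.-tuple R :=
  [tuple frac (tnth x i + tnth y i) | i < m].

Definition torus_pts {R : realType} (m : nat) : set (m.-tuple R) :=
  [set x | forall i, 0 <= tnth x i < 1].

Definition invariant_mx {r m : nat} (L : 'M[int]_(r, m)) : Prop :=
  forall i : 'I_r, \sum_(j < m) L i j = 0.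

Definition kerT {R : realType} {r m : nat} (L : 'M[int]_(r, m)) : set (m.-tuple R) :=
  [set x | @torus_pts R m x /\
     forall i : 'I_r, (\sum_(j < m) (L i j)%:~R * tnth x j : R) \is a Num.int].

(* mu is the normalized Haar probability measure of the compact group ker_T L,
   viewed as a Borel probability measure on T^m concentrated on ker_T L and
   invariant under translations by elements of ker_T L. *)
Definition is_haar_kerT {R : realType} {r m : nat} (L : 'M[int]_(r, m))
    (mu : probability (m.-tuple R) R) : Prop :=
  mu (kerT L) = 1%E /\
  forall t, kerT L t -> forall B, measurable B ->
    mu ((fun x => addT x t) @^-1` B) = mu B.

Definition S_L {R : realType} {r m : nat} (L : 'M[int]_(r, m))
    (mu : probability (m.-tuple R) R) (A : set R) : \bar R :=
  mu ([set x | forall i, A (tnth x i)] `&` kerT L).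

(* L viewed as a rational matrix, to speak of its rank *)
Definition int_mx_to_rat {r m : nat} (L : 'M[int]_(r, m)) : 'M[rat]_(r, m) :=
  map_mx (fun z : int => z%:~R) L.

(* Main.v *)
(** The theorem is a probabilistic consequence of the density Hales-Jewett
    theorem. Let [y_1, ..., y_n] be independent with law [mu], let [x] be
    uniform on the circle, and send a word [u] in [{1..m}^n] to [x + \sum_s
    (y_s)_(u_s)]. Each word goes to a uniform point, so the words landing in
    [A] have expected density the measure of [A]; if [n] is large, some
    combinatorial line lands in [A] with probability bounded below. The points
    of a line form the tuple [x + \sum_(s variable) y_s + constants];
    constant tuples lie in the kernel because [L] is invariant, so by
    translation invariance this tuple has law [mu], and the probability in
    question is [S_L(A)].

    Density Hales-Jewett is proved by induction on the alphabet, passing from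
    [T] to [U = option T], by a density increment as in the Polymath proof. If
    the theorem fails for [U], let [d > 0] be the critical density. Given a
    line-free set of density [d], the inductive hypothesis yields a subspace
    on which the set has density almost [d] and is disjoint from an
    intersection of sets [C_s], [s] in [T], of density bounded below, each
    [C_s] being insensitive to exchanging [None] and [Some s]. So the set is
    denser than [d] on the complement of this intersection, which is almost a
    disjoint union of large subspaces: a contradiction on one of them. *)
From Pilot Require Import Defs.
From HB Require Import structures.
From mathcomp Require Import all_boot all_order all_algebra.
From mathcomp Require Import all_classical all_reals all_analysis.
From mathcomp Require Import measurable_realfun lra.
(* Again, because [fraction] also exports a [frac]. *)
Import Pilot.Defs.
Set Implicit Arguments. Unset Strict Implicit. Unset Printing Implicit Defensive.
Import Order.TTheory GRing.Theory Num.Theory.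
Local Open Scope ring_scope.

(** * Averages over finite types *)

Notation word I T := {ffun I -> T}.

Section Average.
Context {R : realType}.
Implicit Types X Y : finType.

Definition avg X (f : X -> R) : R := (\sum_x f x) / #|X|%:R.
Definition dens X (A : pred X) : R := avg (fun x => (A x)%:R).

Lemma ler_avg X (f g : X -> R) : (forall x, f x <= g x) -> avg f <= avg g.
Proof.
by move=> fg; rewrite ler_wpM2r ?invr_ge0 ?ler0n//; apply: ler_sum => x _.
Qed.

Lemma eq_avg X (f g : X -> R) : f =1 g -> avg f = avg g.
Proof. by move=> fg; congr (_ / _); apply: eq_bigr. Qed.

Lemma avgD X (f g : X -> R) : avg (fun x => f x + g x) = avg f + avg g.
Proof. by rewrite /avg big_split mulrDl. Qed.

Lemma avgZ X c (f : X -> R) : avg (fun x => c * f x) = c * avg f.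
Proof. by rewrite /avg -mulr_sumr mulrA. Qed.

Lemma avgB X (f g : X -> R) : avg (fun x => f x - g x) = avg f - avg g.
Proof. by rewrite /avg sumrB mulrBl. Qed.

Lemma sum_cst X (c : R) : \sum_(x : X) c = #|X|%:R * c.
Proof. by rewrite sumr_const mulr_natl. Qed.

Lemma avg_cst X c : (0 < #|X|)%N -> avg (fun _ : X => c) = c.
Proof.
by move=> X0; rewrite /avg sum_cst mulrC mulKf// pnatr_eq0 -lt0n.
Qed.

Lemma exchange_avg X Y (f : X -> Y -> R) :
  avg (fun x => avg (f x)) = avg (fun y => avg (f^~ y)).
Proof.
rewrite /avg -!mulr_suml exchange_big /= -!mulrA; congr (_ * _).
exact: mulrC.
Qed.

Lemma avg_pair X Y (f : X * Y -> R) :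
  avg f = avg (fun x => avg (fun y => f (x, y))).
Proof.
rewrite /avg -mulr_suml (pair_bigA _ (fun x y => f (x, y)))/= -mulrA.
congr (_ * _); first by apply: eq_bigr => -[].
by rewrite card_prod natrM invfM mulrC.
Qed.

Lemma reindex_avg X Y (h : X -> Y) (f : Y -> R) : bijective h ->
  avg f = avg (fun x => f (h x)).
Proof.
move=> hbij; rewrite /avg (bij_eq_card hbij); congr (_ / _).
exact/reindex/onW_bij.
Qed.

Lemma avg_sum (K : finType) X (f : K -> X -> R) :
  avg (fun x => \sum_k f k x) = \sum_k avg (f k).
Proof. by rewrite /avg exchange_big /= mulr_suml. Qed.

Lemma avg_le_exists X (f : X -> R) : (0 < #|X|)%N -> exists x, avg f <= f x.
Proof.
move=> X0; apply: contrapT => /forallNP fN.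
have fl x : f x < avg f by rewrite ltNge; apply/negP.
have [x0 _] := card_gt0P X0.
have : \sum_x f x < \sum_(x : X) avg f.
  apply: ltr_sum => //; by apply/hasP; exists x0.
by rewrite sum_cst mulrC divfK ?ltxx// pnatr_eq0 -lt0n.
Qed.

Lemma avg_near_max X (f : X -> R) (d g : R) : (forall x, f x <= d + g) ->
  d <= avg f -> 0 <= g -> forall x, d - g * #|X|%:R <= f x.
Proof.
move=> fg df g0 x.
have X0 : (0 < #|X|)%N by apply/card_gt0P; exists x.
have nX : 0 < #|X|%:R :> R by rewrite ltr0n.
have n1 : 1 <= #|X|%:R :> R by rewrite ler1n.
have : \sum_y (f y - (d + g)) <= f x - (d + g).
  rewrite (bigD1 x)//= gerDl; apply: sumr_le0 => y _.
  by rewrite subr_le0.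
move: df; rewrite ler_pdivlMr// sumrB sum_cst => ? ?.
have : 0 <= g * (#|X|%:R - 1) by rewrite mulr_ge0// subr_ge0.
nra.
Qed.

Lemma dens_le1 X (A : pred X) : dens A <= 1.
Proof.
have [X0|X0] := posnP #|X|; first by rewrite /dens /avg X0 invr0 mulr0 ler01.
rewrite -[leRHS](avg_cst 1 X0); apply: ler_avg => x.
by case: (A x); rewrite ?ler01.
Qed.

Lemma dens_ge0 X (A : pred X) : 0 <= dens A.
Proof. by rewrite divr_ge0// sumr_ge0. Qed.

Lemma le_dens X (A B : pred X) : (forall x, A x -> B x) -> dens A <= dens B.
Proof.
move=> AB; apply: ler_avg => x; have := AB x.
by case: (A x) => [->//|_]; rewrite ler0n.
Qed.

Lemma avg_markov X (f : X -> R) (a : R) : (forall x, f x <= 1) -> 0 <= a ->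
  a <= avg f -> a / 2 <= dens (fun x => a / 2 <= f x).
Proof.
move=> f1 a0; have [X0|X0] := posnP #|X|.
  by rewrite /dens /avg X0 invr0 !mulr0 => ?; lra.
move=> af; suff : avg f <= dens (fun x => a / 2 <= f x) + a / 2.
  by move=> h; rewrite -(lerD2r (a / 2)) -splitr (le_trans af).
rewrite -[X in _ + X](avg_cst (a / 2) X0) /dens -avgD; apply: ler_avg => x.
by have ? := f1 x; have [?|?] := leP (a / 2) (f x); rewrite /=; lra.
Qed.

End Average.

(** * Words and subspaces *)

Section Words.
Context {T : finType}.
Implicit Types I J K : finType.

Definition cat I J (x : word I T) (y : word J T) : word (I + J)%type T :=
  [ffun s => match s with inl i => x i | inr j => y j end].

Lemma cat_bij I J : bijective (fun p : word I T * word J T => cat p.1 p.2).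
Proof.
exists (fun z : word (I + J)%type T =>
  ([ffun i => z (inl i)], [ffun j => z (inr j)])).
  by move=> [x y]; congr (_, _); apply/ffunP => i; rewrite !ffunE.
by move=> z; apply/ffunP => -[i|j]; rewrite !ffunE.
Qed.

Lemma avg_cat {R : realType} I J (f : word (I + J)%type T -> R) :
  avg f = avg (fun x => avg (fun y => f (cat x y))).
Proof. by rewrite (reindex_avg _ (@cat_bij I J)) avg_pair. Qed.

Lemma dens_catl {R : realType} I J (A : pred (word (I + J)%type T)) :
  dens A = avg (fun x => dens (fun y => A (cat x y))) :> R.
Proof. exact: avg_cat. Qed.

Lemma dens_catr {R : realType} I J (A : pred (word (I + J)%type T)) :
  dens A = avg (fun y => dens (fun x => A (cat x y))) :> R.
Proof. by rewrite dens_catl; exact: exchange_avg. Qed.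

(* A subspace of [T^I] of dimension [J]: every coordinate [i] is either fixed
   or carries one of the variables, and every variable occurs. *)
Definition sub I J (g : I -> T + J) (v : word J T) : word I T :=
  [ffun i => match g i with inl c => c | inr j => v j end].

Definition onto I J (g : I -> T + J) := forall j, exists i, g i = inr j.

Definition sub_comp I J K (g : I -> T + J) (h : J -> T + K) (i : I) : T + K :=
  match g i with inl c => inl c | inr j => h j end.

Lemma sub_compE I J K (g : I -> T + J) (h : J -> T + K) v :
  sub (sub_comp g h) v = sub g (sub h v).
Proof.
by apply/ffunP => i; rewrite !ffunE /sub_comp; case: (g i) => // j; rewrite ffunE.
Qed.

Lemma onto_comp I J K (g : I -> T + J) (h : J -> T + K) :
  onto g -> onto h -> onto (sub_comp g h).
Proof.
move=> og oh k; have [j hj] := oh k; have [i gi] := og j.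
by exists i; rewrite /sub_comp gi.
Qed.

Lemma sub_inj I J (g : I -> T + J) : onto g -> injective (sub g).
Proof.
move=> og v w /ffunP vw; apply/ffunP => j; have [i gi] := og j.
by have := vw i; rewrite !ffunE gi.
Qed.

Definition fixr I J K (g : I -> T + K) (y : word J T) (s : I + J) : T + K :=
  match s with inl i => g i | inr j => inl (y j) end.

Definition fixl I J K (x : word I T) (g : J -> T + K) (s : I + J) : T + K :=
  match s with inl i => inl (x i) | inr j => g j end.

Lemma sub_fixr I J K (g : I -> T + K) (y : word J T) v :
  sub (fixr g y) v = cat (sub g v) y.
Proof. by apply/ffunP => -[i|j]; rewrite !ffunE. Qed.

Lemma sub_fixl I J K (x : word I T) (g : J -> T + K) v :
  sub (fixl x g) v = cat x (sub g v).
Proof. by apply/ffunP => -[i|j]; rewrite !ffunE. Qed.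

Lemma onto_fixr I J K (g : I -> T + K) (y : word J T) :
  onto g -> onto (fixr g y).
Proof. by move=> og k; have [i gi] := og k; exists (inl i). Qed.

Lemma onto_fixl I J K (x : word I T) (g : J -> T + K) :
  onto g -> onto (fixl x g).
Proof. by move=> og k; have [i gi] := og k; exists (inr i). Qed.

Lemma sub_inr I (v : word I T) : sub inr v = v.
Proof. by apply/ffunP => i; rewrite ffunE. Qed.

Lemma onto_inr I : onto (@inr T I).
Proof. by move=> j; exists j. Qed.

Lemma word_gt0 I : T -> (0 < #|{: word I T}|)%N.
Proof. by move=> t; apply/card_gt0P; exists [ffun=> t]. Qed.

Lemma avg_le_sub {R : realType} I J (f : word I T -> R) : T ->
  (#|J| <= #|I|)%N ->
  exists2 g : I -> T + J, onto g & avg f <= avg (fun v => f (sub g v)).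
Proof.
move=> t JI; pose K := 'I_(#|I| - #|J|).
have IJK : #|I| = #|{: J + K}| by rewrite card_sum card_ord subnKC.
pose h (i : I) : J + K := enum_val (cast_ord IJK (enum_rank i)).
pose h' (s : J + K) : I := enum_val (cast_ord (esym IJK) (enum_rank s)).
have hK : cancel h h' by move=> i; rewrite /h' enum_valK cast_ordK enum_rankK.
have h'K : cancel h' h by move=> i; rewrite /h enum_valK cast_ordKV enum_rankK.
pose H (z : word (J + K)%type T) : word I T := [ffun i => z (h i)].
have Hbij : bijective H.
  exists (fun x : word I T => [ffun s => x (h' s)]) => z;
  by apply/ffunP => i; rewrite !ffunE ?hK ?h'K.
rewrite (reindex_avg _ Hbij) avg_cat exchange_avg.
have [y fy] := avg_le_exists
  (fun y : word K T => avg (fun x : word J T => f (H (cat x y)))) (word_gt0 _ t).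
exists (fun i => fixr (@inr T J) y (h i)).
  by move=> j; exists (h' (inl j)); rewrite h'K.
rewrite (le_trans fy)//; apply: ler_avg => x; rewrite le_eqVlt; apply/orP; left.
apply/eqP; congr f; apply/ffunP => i; rewrite !ffunE.
by case: (h i).
Qed.

End Words.

Definition hereditary (T : finType) (P : forall I : finType, pred (word I T) -> Prop) :=
  forall (I J : finType) (g : I -> T + J) A,
    onto g -> P I A -> P J (fun v => A (sub g v)).

Lemma hereditary_fixl (T : finType) (P : forall I : finType, pred (word I T) -> Prop)
    (I J : finType) (x : word I T) A : hereditary P ->
  P (I + J)%type A -> P J (fun y : word J T => A (cat x y)).
Proof.
move=> hP /(hP _ _ _ _ (onto_fixl x (@onto_inr T J))).
by congr P; apply/funext => y; rewrite sub_fixl sub_inr.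
Qed.

Lemma hereditary_fixr (T : finType) (P : forall I : finType, pred (word I T) -> Prop)
    (I J : finType) (y : word J T) A : hereditary P ->
  P (I + J)%type A -> P I (fun x : word I T => A (cat x y)).
Proof.
move=> hP /(hP _ _ _ _ (onto_fixr y (@onto_inr T I))).
by congr P; apply/funext => x; rewrite sub_fixr sub_inr.
Qed.

Lemma threshold (R : realType) (T : finType)
    (P : forall I : finType, pred (word I T) -> Prop) : T -> hereditary P ->
  ~ (forall e : R, 0 < e -> exists N, forall I : finType, (N <= #|I|)%N ->
      forall A, P I A -> dens A < e) ->
  exists d : R, [/\ 0 < d, forall I : finType, exists2 A, P I A & d <= dens A
   & forall e, 0 < e -> exists N, forall I : finType, (N <= #|I|)%N ->
      forall A, P I A -> dens A < d + e].
Proof.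
move=> t hP /existsNP[e /not_implyP[e0 /forallNP eN]].
have restr (I J : finType) A : (#|J| <= #|I|)%N -> P I A ->
    exists2 B, P J B & (dens A : R) <= dens B.
  move=> JI PA; have [g og Ag] := avg_le_sub (fun x => (A x)%:R : R) t JI.
  by exists (fun v => A (sub g v)) => //; exact: hP.
pose S : set R := fun d => forall I : finType, exists2 A, P I A & d <= dens A.
have Se : S e.
  move=> J; have /existsNP[I /not_implyP[JI /existsNP[A]]] := eN #|J|.
  move=> /not_implyP[PA /negP]; rewrite -leNgt => eA.
  by have [B PB AB] := restr I J A JI PA; exists B => //; rewrite (le_trans eA).
have Sub : has_sup S.
  split; first by exists e.
  exists 1 => d /(_ void)[A _ /le_trans]; apply; exact: dens_le1.
exists (sup S); split.
- by rewrite (lt_le_trans e0)//; apply: sup_upper_bound.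
- move=> I; have [A0 PA0 _] := Se I.
  pose Q (A : {ffun word I T -> bool}) := `[< P I A >].
  have QA0 : Q [ffun x => A0 x].
    apply/asboolP; congr (P I _) : PA0; apply/funext => x; by rewrite ffunE.
  have [A /asboolP PA Amax] :=
    arg_maxP (fun A : {ffun word I T -> bool} => (dens A : R)) QA0.
  exists A => //; apply: ge_sup; first by exists e.
  move=> d /(_ I)[B PB /le_trans]; apply.
  have eB : B = [ffun x => B x] :> (_ -> _) by apply/funext => x; rewrite ffunE.
  by rewrite [in leLHS]eB; apply: Amax; apply/asboolP; rewrite -eB.
- move=> a a0; have /existsNP[J nJ] : ~ S (sup S + a).
    move=> /(sup_upper_bound Sub); lra.
  exists #|J| => I JI A PA; rewrite ltNge; apply/negP => aA.
  apply: nJ; have [B PB AB] := restr I J A JI PA; exists B => //.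
  exact: le_trans AB.
Qed.

(** * Lines and insensitive sets *)

Section Lines.
Context {T : finType}.
Implicit Types I J K : finType.

(* Lines of [T^I] are words over [option T] in which the variable [None]
   occurs. *)
Definition pt I (w : word I (option T)) (t : T) : word I T :=
  [ffun i => odflt t (w i)].

Definition variable I (w : word I (option T)) := [exists i, w i == None].

Definition linefree I (A : pred (word I T)) :=
  forall w, variable w -> ~ forall t, A (pt w t).

Lemma linefree_hereditary : hereditary linefree.
Proof.
move=> I J g A og Afree w /existsP[j /eqP wj] wA.
pose w' : word I (option T) :=
  [ffun i => match g i with inl c => Some c | inr j => w j end].
apply: (Afree w').
  by have [i gi] := og j; apply/existsP; exists i; rewrite ffunE gi wj.
move=> t; have := wA t; congr (is_true (A _)); apply/ffunP => i; rewrite !ffunE.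
by case: (g i) => // k; rewrite ffunE.
Qed.

End Lines.

Definition DHJ (R : realType) (T : finType) := forall e : R, 0 < e ->
  exists N, forall I : finType, (N <= #|I|)%N ->
    forall A : pred (word I T), linefree A -> dens A < e.

Section Insensitive.
Context {T : finType}.
Local Notation U := (option T).
Implicit Types (I J K : finType) (t : T).

Definition rep I t (x : word I U) : word I U := [ffun i => Some (odflt t (x i))].

Definition insens I t (A : pred (word I U)) := forall x, A (rep t x) = A x.

Lemma rep_cat I J t (x : word I U) (y : word J U) :
  rep t (cat x y) = cat (rep t x) (rep t y).
Proof. by apply/ffunP => -[i|j]; rewrite !ffunE. Qed.

Lemma rep_idem I t (x : word I U) : rep t (rep t x) = rep t x.
Proof. by apply/ffunP => i; rewrite !ffunE. Qed.

Lemma rep_sub I J t (g : I -> U + J) v : rep t (sub g (rep t v)) = rep t (sub g v).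
Proof.
by apply/ffunP => i; rewrite !ffunE; case: (g i) => // j; rewrite ffunE.
Qed.

Lemma insens_hereditary t : hereditary (fun I => @insens I t).
Proof.
by move=> I J g A _ iA v; rewrite -[LHS]iA rep_sub iA.
Qed.

Lemma insens_fixl I J t (x : word I U) (A : pred (word (I + J)%type U)) :
  insens t A -> insens t (fun y => A (cat x y)).
Proof. exact: (hereditary_fixl x (@insens_hereditary t)). Qed.

Lemma insens_rep_fixl I J t (A : pred (word (I + J)%type U)) (x x' : word I U) :
  insens t A -> rep t x = rep t x' -> forall y, A (cat x y) = A (cat x' y).
Proof. by move=> iA xx' y; rewrite -[LHS]iA -[RHS]iA !rep_cat xx'. Qed.

Lemma insens_line (R : realType) t : DHJ R T -> forall e : R, 0 < e ->
  exists N, forall I : finType, (N <= #|I|)%N ->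
    forall A : pred (word I U), insens t A -> linefree A -> dens A < e.
Proof.
move=> dhj; pose P I (A : pred (word I U)) := insens t A /\ linefree A.
suff : forall e : R, 0 < e -> exists N, forall I : finType, (N <= #|I|)%N ->
    forall A, P I A -> dens A < e.
  by move=> h e /h[N hN]; exists N => I NI A iA fA; apply: hN.
have hP : hereditary P.
  move=> I J g A og [iA fA].
  by split; [exact: insens_hereditary iA | exact: linefree_hereditary fA].
apply: contrapT => /(threshold None hP)[d [d0 Pd Pd']].
have [N0 hN0] : exists N, _ := dhj (d / 2) ltac:(lra).
pose M := 'I_N0; pose n : R := #|{: word M U}|%:R.
have n0 : 0 < n by rewrite ltr0n (word_gt0 _ None).
have [N hN] := Pd' (d / 2 / n) ltac:(rewrite !divr_gt0//; lra).
have [A [iA fA] dA] := Pd ('I_N0 + 'I_N)%type.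
have secA x : d / 2 <= dens (fun y => A (cat x y)).
  have -> : d / 2 = d - (d / 2 / n) * n by rewrite divfK ?gt_eqF//; lra.
  have gn : 0 <= d / 2 / n by rewrite !divr_ge0// ltW.
  move: x; apply: avg_near_max gn; last by rewrite -dens_catl.
  move=> x; apply/ltW/hN; first by rewrite card_ord.
  exact: (hereditary_fixl x hP (conj iA fA)).
have [y dy] : exists y, d / 2 <=
    dens (fun v : word M T => A (cat [ffun i => Some (v i)] y)).
  have [y dy] := avg_le_exists
    (fun y => dens (fun v : word M T => A (cat [ffun i => Some (v i)] y)) : R)
    (word_gt0 _ None).
  exists y; rewrite (le_trans _ dy)// /dens exchange_avg.
  rewrite -[leLHS](@avg_cst _ {: word M T} _ (word_gt0 _ t)).
  by apply: ler_avg => v; exact: secA.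
have : ~ linefree (fun v : word M T => A (cat [ffun i => Some (v i)] y)).
  by move=> /hN0; rewrite card_ord ltNge dy => /(_ (leqnn _)).
move=> /existsNP[w /not_implyP[/existsP[i /eqP wi] /contrapT wA]].
pose w' : word (M + 'I_N)%type (option U) :=
  [ffun s => match s with inl i => omap Some (w i) | inr j => Some (y j) end].
apply: (fA w'); first by apply/existsP; exists (inl i); rewrite ffunE wi.
have wS s : A (pt w' (Some s)).
  have := wA s; congr (is_true (A _)); apply/ffunP => -[k|k]; rewrite !ffunE//.
  by case: (w k).
case=> [s|]; first exact: wS.
have := wS t; rewrite -[in X in X -> _]iA -[in X in _ -> X]iA.
congr (is_true (A _)); apply/ffunP => -[k|k]; rewrite !ffunE//.
by case: (w k).
Qed.
End Insensitive.

(** * Subspaces in insensitive sets *)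

Section InsensitiveSubspaces.
Context {R : realType} {T : finType}.
Local Notation U := (option T).
Implicit Types (I J K : finType) (t : T).

Lemma insens_sub_ord t : DHJ R T -> forall m (e : R), 0 < e ->
  exists I : finType, forall A : pred (word I U), insens t A -> e <= dens A ->
    exists2 g : I -> U + 'I_m, onto g & forall v, A (sub g v).
Proof.
move=> dhj; elim=> [e e0|m IH e e0].
  exists 'I_0 => A _ dA; exists inr => [[]//|v].
  have [x Ax] := avg_le_exists (fun x => (A x)%:R : R) (word_gt0 'I_0 (None : U)).
  have -> : sub inr v = x by apply/ffunP => -[].
  have := le_trans dA Ax; case: (A x) => //=.
  by rewrite leNgt e0.
have [N hN] := insens_line t dhj (e := e / 2) ltac:(lra).
pose M := 'I_N; pose nl : R := #|{: word M (option U)}|%:R.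
have nl0 : 0 < nl by rewrite ltr0n (word_gt0 _ None).
have [I' hI'] := IH (e / 2 / nl) ltac:(rewrite !divr_gt0//; lra).
exists (M + I')%type => A iA dA.
pose B w y := variable w && [forall s, A (cat (pt w s) y)].
have [w dw] : exists w, e / 2 / nl <= dens (B w).
  have [w hw] := avg_le_exists (fun w => dens (B w) : R)
    (word_gt0 M (None : option U)).
  exists w; rewrite (le_trans _ hw)// /avg ler_pM2r ?invr_gt0//.
  move: dA; rewrite dens_catr => /(avg_markov (fun y => dens_le1 _) (ltW e0)).
  move=> /le_trans; apply; rewrite -avg_sum; apply: ler_avg => y.
  have [ey|_] := leP (e / 2) _; last by rewrite sumr_ge0.
  have : ~ linefree (fun x => A (cat x y)).
    move=> /(hN M _ _); rewrite card_ord leqnn => /(_ isT); rewrite ltNge ey.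
    move=> h; apply/notF/h.
    exact: (hereditary_fixr y (@insens_hereditary T t)) iA.
  move=> /existsNP[u /not_implyP[vu /contrapT uA]].
  rewrite (bigD1 u)//= {1}/B vu; have -> : [forall s, A (cat (pt u s) y)].
    exact/forallP.
  by rewrite lerDl sumr_ge0.
have vw : variable w.
  apply: contraTT dw => /negPf nw; rewrite -ltNge.
  rewrite (le_lt_trans (y := 0))//; last by rewrite !divr_gt0//; lra.
  by rewrite /dens /avg big1 ?mul0r// => y _; rewrite /B nw.
have iB : insens t (B w).
  move=> y; rewrite /B; congr (_ && _); apply: eq_forallb => s.
  exact: (insens_fixl _ iA).
have [g og gB] := hI' _ iB dw.
exists (fun s => match s with
  | inl i => if w i is Some c then inl c else inr ord0
  | inr i => match g i with inl c => inl c | inr j => inr (lift ord0 j) end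
  end).
  move=> j; case: (unliftP ord0 j) => [k ->|->].
    by have [i gi] := og k; exists (inr i); rewrite gi.
  by have /existsP[i /eqP wi] := vw; exists (inl i); rewrite wi.
move=> v; have /andP[_ /forallP/(_ (v ord0))] := gB [ffun j => v (lift ord0 j)].
congr (is_true (A _)); apply/ffunP => -[i|i]; rewrite !ffunE.
  by case: (w i).
by case: (g i) => // j; rewrite ffunE.
Qed.

Lemma insens_sub t J (e : R) : DHJ R T -> 0 < e ->
  exists I : finType, forall A : pred (word I U), insens t A -> e <= dens A ->
    exists2 g : I -> U + J, onto g & forall v, A (sub g v).
Proof.
move=> dhj /(insens_sub_ord t dhj #|J|)[I hI]; exists I => A iA /(hI A iA)[g og gA].
exists (sub_comp g (fun j => inr (enum_val j))).
  by apply: onto_comp og _ => j; exists (enum_rank j); rewrite enum_rankK.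
by move=> v; rewrite sub_compE.
Qed.

End InsensitiveSubspaces.

Section Packing.
Context {R : realType} {T : finType}.
Local Notation U := (option T).
Implicit Types (I J K : finType) (t : T).

(* Satisfied by every disjoint union of [J]-dimensional subspaces. *)
Definition packed I J (D : pred (word I U)) := forall f : word I U -> R,
  (forall g : I -> U + J, onto g -> avg (fun v => f (sub g v)) <= 0) ->
  avg (fun x => (D x)%:R * f x) <= 0.

Lemma packed_all I J : (#|J| <= #|I|)%N -> packed J (@predT (word I U)).
Proof.
move=> JI f fJ; have [g /fJ fg] := avg_le_sub f None JI.
move=> /le_trans/(_ fg); apply: le_trans; apply: ler_avg => x.
by rewrite mul1r.
Qed.

Lemma packed_disjointU I J (D D1 D2 : pred (word I U)) :
  (forall x, (D x)%:R = (D1 x)%:R + (D2 x)%:R :> R) ->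
  packed J D1 -> packed J D2 -> packed J D.
Proof.
move=> DD p1 p2 f fJ.
under eq_avg do rewrite DD mulrDl.
by rewrite avgD -[leRHS]addr0 lerD ?p1 ?p2.
Qed.

Lemma packed_fixl I J K (D : pred (word (I + K)%type U)) :
  (forall x, packed J (fun y => D (cat x y))) -> packed J D.
Proof.
move=> pD f fJ; rewrite avg_cat -[leRHS](avg_cst 0 (word_gt0 I (None : U))).
apply: ler_avg => x; apply: (pD x (fun y => f (cat x y))) => g og.
by under eq_avg do rewrite -sub_fixl; apply/fJ/onto_fixl.
Qed.

Lemma packed_fixr I J K (D : pred (word (I + K)%type U)) :
  (forall y, packed J (fun x => D (cat x y))) -> packed J D.
Proof.
move=> pD f fJ; rewrite avg_cat exchange_avg.
rewrite -[leRHS](avg_cst 0 (word_gt0 K (None : U))).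
apply: ler_avg => y; apply: (pD y (fun x => f (cat x y))) => g og.
by under eq_avg do rewrite -sub_fixr; apply/fJ/onto_fixr.
Qed.

Definition im I J (g : I -> U + J) : pred (word I U) :=
  fun x => [exists v, x == sub g v].

Lemma avg_im I J (g : I -> U + J) (f : word I U -> R) : onto g ->
  avg (fun x => (im g x)%:R * f x) =
  #|{: word J U}|%:R / #|{: word I U}|%:R * avg (fun v => f (sub g v)).
Proof.
move=> og; have J0 : #|{: word J U}|%:R != 0 :> R.
  by rewrite pnatr_eq0 -lt0n (word_gt0 _ None).
rewrite /avg [RHS]mulrC -mulrA mulKf//; congr (_ / _).
transitivity (\sum_x \sum_v (if x == sub g v then f x else 0)); last first.
  by rewrite exchange_big; apply: eq_bigr => v _; rewrite -big_mkcond big_pred1_eq.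
apply: eq_bigr => x _; rewrite /im; case: existsP => [[v /eqP ->]|nx].
  rewrite mul1r (bigD1 v)//= eqxx big1 ?addr0// => w wv.
  by rewrite (inj_eq (sub_inj og)) eq_sym (negPf wv).
by rewrite mul0r big1// => v _; case: eqP => // xv; case: nx; exists v; apply/eqP.
Qed.

Lemma packed_im I J (g : I -> U + J) : onto g -> packed J (im g).
Proof.
by move=> og f fJ; rewrite avg_im// mulr_ge0_le0 ?fJ// ?divr_ge0.
Qed.

(* Depends on nothing but [Q], which keeps the remainders below insensitive. *)
Definition block I J (Q : pred (word I U)) : pred (word I U) :=
  if [pick g : {ffun I -> U + J} | `[< onto g >] && [forall v, Q (sub g v)]]
  is Some g then im g else pred0.

Lemma block_sub I J (Q : pred (word I U)) x : block J Q x -> Q x.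
Proof.
rewrite /block; case: pickP => // g /andP[_ /forallP gQ] /existsP[v /eqP ->].
exact: gQ.
Qed.

Lemma packed_block I J (Q : pred (word I U)) : packed J (block J Q).
Proof.
rewrite /block; case: pickP => [g /andP[/asboolP og _]|_ f _].
  exact: packed_im.
by rewrite /avg big1 ?mul0r// => x _; rewrite mul0r.
Qed.

Lemma dens_block I J (Q : pred (word I U)) :
  (exists2 g : I -> U + J, onto g & forall v, Q (sub g v)) ->
  dens (block J Q) = #|{: word J U}|%:R / #|{: word I U}|%:R :> R.
Proof.
move=> [g og gQ]; rewrite /block; case: pickP => [h /andP[/asboolP oh _]|].
  have := avg_im (fun=> 1) oh; rewrite avg_cst ?(word_gt0 _ None)// mulr1 => <-.
  by apply: eq_avg => x; rewrite mulr1.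
have eg : [ffun i => g i] = g :> (_ -> _) by apply/funext => i; rewrite ffunE.
move=> /(_ [ffun i => g i]) /negP[]; rewrite eg.
by apply/andP; split; [apply/asboolP|apply/forallP].
Qed.

Definition lft I K (z : word (I + K)%type U) : word I U := [ffun i => z (inl i)].
Definition rgt I K (z : word (I + K)%type U) : word K U := [ffun i => z (inr i)].

Lemma lft_cat I K (x : word I U) (y : word K U) : lft (cat x y) = x.
Proof. by apply/ffunP => i; rewrite !ffunE. Qed.

Lemma rgt_cat I K (x : word I U) (y : word K U) : rgt (cat x y) = y.
Proof. by apply/ffunP => i; rewrite !ffunE. Qed.

Lemma cat_lft_rgt I K (z : word (I + K)%type U) : cat (lft z) (rgt z) = z.
Proof. by apply/ffunP => -[i|i]; rewrite !ffunE. Qed.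

(* [r E] is what remains of [E] after removing disjoint subspaces.  Each step
   adds fresh coordinates [M]: since [r E_x] depends only on [E_x], the
   remainder is still insensitive in [M], so that another subspace can be
   removed from each of its dense fibres. *)
Lemma insens_remainder_step t J (e : R) : DHJ R T -> 0 < e ->
  exists2 c : R, 0 < c & forall n : nat,
  exists2 I : finType, (#|J| <= #|I|)%N &
  exists r : pred (word I U) -> pred (word I U), forall E, insens t E ->
    [/\ forall x, r E x -> E x, packed J (fun x => E x && ~~ r E x)
      & dens (r E) <= Num.max e (1 - n%:R * c)].
Proof.
move=> dhj e0; have [M hM] := insens_sub t J dhj (e := e / 2) ltac:(lra).
pose k : R := #|{: word J U}|%:R / #|{: word M U}|%:R.
have k0 : 0 < k by rewrite divr_gt0// ltr0n (word_gt0 _ None).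
exists (e / 2 * k); first by rewrite mulr_gt0//; lra.
elim=> [|n [I JI [r hr]]].
  exists J => //; exists id => E _; split=> // [f _|].
    by rewrite /avg big1 ?mul0r// => x _; rewrite andbN mul0r.
  by rewrite mul0r subr0 le_max dens_le1 orbT.
exists (M + I)%type; first by rewrite card_sum (leq_trans JI)// leq_addl.
pose Ex (E : pred (word (M + I)%type U)) x := r (fun y => E (cat x y)).
pose Q E y : pred (word M U) := fun x => Ex E x y.
exists (fun E z => Ex E (lft z) (rgt z) && ~~ block J (Q E (rgt z)) (lft z)).
move=> E iE; have hEx x := hr _ (insens_fixl x iE); split.
- move=> z /andP[rz _]; have [/(_ _ rz) + _ _] := hEx (lft z).
  by rewrite cat_lft_rgt.
- apply: (@packed_disjointU _ _ _ (fun z => E z && ~~ Ex E (lft z) (rgt z))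
    (fun z => block J (Q E (rgt z)) (lft z))).
  + move=> z; rewrite -[in E z](cat_lft_rgt z); have [/(_ (rgt z)) rE _ _] := hEx (lft z).
    have := @block_sub _ J (Q E (rgt z)) (lft z); rewrite /Q.
    move: rE; rewrite -/(Ex _ _).
    case: (E _); case: (Ex _ _ _); case: (block _ _ _) => //= rE bE;
      rewrite ?addr0 ?add0r//; by [have := bE isT | have := rE isT].
  + apply: packed_fixl => x.
    have [_ + _] := hEx x; congr packed; apply/funext => y.
    by rewrite lft_cat rgt_cat.
  + apply: packed_fixr => y; have := @packed_block _ J (Q E y).
    by congr packed; apply/funext => x; rewrite lft_cat rgt_cat.
- set S := fun z => _.
  pose rho : R := avg (fun y => dens (Q E y)).
  have Srho : dens S = rho - avg (fun y => dens (block J (Q E y))).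
    rewrite dens_catr -avgB; apply: eq_avg => y; rewrite -avgB; apply: eq_avg => x.
    rewrite /S lft_cat rgt_cat -/(Q E y x).
    have := @block_sub _ J (Q E y) x.
    by case: (Q _ _ _); case: (block _ _ _) => //=;
      rewrite ?subr0 ?subrr// => /(_ isT).
  have rhole : rho <= Num.max e (1 - n%:R * (e / 2 * k)).
    rewrite /rho /dens exchange_avg.
    rewrite -[leRHS](avg_cst _ (word_gt0 M (None : U))).
    by apply: ler_avg => x; have [_ _] := hEx x.
  have bl0 : 0 <= avg (fun y => dens (block J (Q E y))) :> R.
    rewrite -[leLHS](avg_cst _ (word_gt0 I (None : U))).
    by apply: ler_avg => x; exact: dens_ge0.
  rewrite le_max; have [rhoe|erho] := leP rho e.
    by apply/orP; left; rewrite Srho; lra.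
  apply/orP; right; rewrite Srho -natr1.
  have rhole' : rho <= 1 - n%:R * (e / 2 * k).
    by move: rhole; rewrite le_max leNgt erho.
  suff : e / 2 * k <= avg (fun y => dens (block J (Q E y))) by lra.
  rewrite mulrC (le_trans (ler_wpM2l (ltW k0)
    (avg_markov (fun y => dens_le1 _) (ltW e0) (ltW erho))))//.
  rewrite -avgZ; apply: ler_avg => y; have [ey|_] := leP (e / 2) _; last first.
    by rewrite mulr0 dens_ge0.
  rewrite mulr1 (dens_block (hM _ _ ey))// => x; rewrite /Q /Ex.
  congr r; apply/funext => y'; apply: insens_rep_fixl => //.
  exact: rep_idem.
Qed.

End Packing.

Section Filling.
Context {R : realType} {T : finType}.
Local Notation U := (option T).
Implicit Types (I J K : finType) (t : T).

Definition filled (e : R) I J (D : pred (word I U)) := forall f : word I U -> R,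
  (forall x, f x <= 1) ->
  (forall g : I -> U + J, onto g -> avg (fun v => f (sub g v)) <= 0) ->
  avg (fun x => (D x)%:R * f x) <= e.

Lemma insens_filled t J (e : R) : DHJ R T -> 0 < e ->
  exists2 I : finType, (#|J| <= #|I|)%N &
    forall E : pred (word I U), insens t E -> filled e J E.
Proof.
move=> dhj e0; have [c c0 hc] := insens_remainder_step t J dhj e0.
have [I JI [r hr]] := hc (Num.truncn c^-1).+1.
exists I => // E /hr[rE pE dr] f f1 fJ.
have {}dr : dens (r E) <= e.
  rewrite (le_trans dr)// ge_max lexx/= lerBlDr ler_wpDl ?ltW//.
  by rewrite -ltr_pdivrMr// div1r truncnS_gt.
have -> : avg (fun x => (E x)%:R * f x) =
    avg (fun x => (E x && ~~ r E x)%:R * f x) + avg (fun x => (r E x)%:R * f x).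
  rewrite -avgD; apply: eq_avg => x; have := rE x.
  by case: (E x); case: (r E x) => //= h; rewrite ?mul0r ?addr0 ?add0r//; have := h isT.
rewrite -[leRHS]add0r lerD ?pE// (le_trans _ dr)//; apply: ler_avg => x.
by case: (r E x); rewrite ?mul1r ?mul0r.
Qed.

(* The complement of [C_a /\ D] splits into the complement of [C_a] and the
   part of [C_a] outside [D]; the latter is filled by filling [C_a] with
   subspaces large enough for the complement of [D] to be filled inside each
   of them. *)
Lemma insens_inter_filled (l : seq T) J (e : R) : DHJ R T -> 0 < e ->
  exists2 I : finType, (#|J| <= #|I|)%N &
    forall C : T -> pred (word I U), (forall t, insens t (C t)) ->
      filled e J (fun x => ~~ all (C^~ x) l).
Proof.
move=> dhj; elim: l e => [|a l IH] e e0.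
  exists J => // C _ f _ _.
  by rewrite /avg big1 ?mul0r ?ltW// => x _; rewrite mul0r.
have [I' JI' hI'] := IH (e / 2) ltac:(lra).
have [I I'I hI] := insens_filled a I' dhj (e := e / 4) ltac:(lra).
exists I => [|C iC f f1 fJ]; first exact: leq_trans I'I.
have -> : avg (fun x => (~~ all (C^~ x) (a :: l))%:R * f x) =
    avg (fun x => (~~ C a x)%:R * f x) +
    avg (fun x => (C a x)%:R * ((~~ all (C^~ x) l)%:R * f x)).
  rewrite -avgD; apply: eq_avg => x /=.
  by case: (C a x) => /=; rewrite ?mul1r ?mul0r ?addr0 ?add0r.
have h1 : avg (fun x => (~~ C a x)%:R * f x) <= e / 4.
  apply: (hI (fun x => ~~ C a x)) => // [x|g og]; first by rewrite iC.
  have := packed_all JI' (f := fun v => f (sub g v)).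
  under eq_avg do rewrite mul1r.
  apply=> h oh; under eq_avg do rewrite -sub_compE.
  by apply/fJ/onto_comp.
have : avg (fun x => (C a x)%:R * ((~~ all (C^~ x) l)%:R * f x - e / 2)) <= e / 4.
  apply: (hI (C a)) => // [x|g og].
    by have := f1 x; case: all => /=; rewrite ?mul1r ?mul0r; lra.
  rewrite avgB avg_cst ?(word_gt0 _ None)// subr_le0.
  apply: (hI' (fun t v => C t (sub g v))) => // [t|h oh].
    exact: (insens_hereditary (t := t)) og (iC t).
  under eq_avg do rewrite -sub_compE.
  by apply/fJ/onto_comp.
under eq_avg do rewrite mulrBr [_ * (e / 2)]mulrC.
rewrite avgB avgZ => h2; have := dens_le1 (R := R) (C a); rewrite /dens.
by move: h1 h2; set x := avg _; set y := avg _; set z := avg _; nra.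
Qed.

End Filling.

(** * The density Hales-Jewett theorem *)

Definition set_row (I J T : finType) (p : I) (o : word (I * J)%type T)
    (x : word J T) : word (I * J)%type T :=
  [ffun q => if q.1 == p then x q.2 else o q].

Lemma avg_set_row (R : realType) (I J T : finType) (p : I)
    (F : word (I * J)%type T -> R) : T ->
  avg F = avg (fun o => avg (fun x => F (set_row p o x))).
Proof.
move=> t; rewrite -(avg_pair (fun c => F (set_row p c.1 c.2))).
pose swap (c : word (I * J)%type T * word J T) :=
  (set_row p c.1 c.2, [ffun k => c.1 (p, k)] : word J T).
have swapK : involutive swap.
  move=> [z x]; congr (_, _); apply/ffunP; last by move=> k; rewrite !ffunE eqxx.
  by move=> [q k]; rewrite !ffunE/=; case: eqP => [->|].
rewrite [RHS](reindex_avg _ (inv_bij swapK)) avg_pair; apply: eq_avg => o.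
rewrite -[LHS](@avg_cst _ {: word J T} _ (word_gt0 _ t)); apply: eq_avg => x.
by have := swapK (o, x) => -[->].
Qed.

Section Step.
Context {R : realType} {T : finType}.
Local Notation U := (option T).
Implicit Types (I J K : finType) (t : T).

(* When [w p] is the variable, row [p] of [z] appears unchanged as a variable
   word.  Hence, whatever the line [w], a uniform [z] yields a uniform variable
   word of [U^J], and no measure other than the uniform one is needed. *)
Definition insert_rows I J (z : word (I * J)%type U) (w : word I U) :
    word (I + I * J)%type U :=
  [ffun s => match s with
   | inl p => w p
   | inr q => if z q is Some a then Some a else w q.1
   end].

Lemma insert_rows_pt I J (z : word (I * J)%type U) (w : word I U) t :
  insert_rows z [ffun i => Some (pt w t i)] = rep t (insert_rows z w).
Proof. by apply/ffunP => -[p|q]; rewrite !ffunE//; case: (z q). Qed.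

Lemma DHJ_option t0 : DHJ R T -> DHJ R U.
Proof.
move=> dhj; apply: contrapT.
move=> /(threshold None (@linefree_hereditary U))[d [d0 Pd Pd']].
have d1 : d <= 1 by have [A _ /le_trans] := Pd void; apply; exact: dens_le1.
have [N0 hN0] : exists N, _ := dhj (d / 4) ltac:(lra).
pose M := 'I_N0; pose nl : R := #|{: word M U}|%:R.
have nl1 : 1 <= nl by rewrite ler1n (word_gt0 _ None).
pose th : R := d / 4 / nl.
have nl0 : 0 < nl by exact: lt_le_trans nl1.
have th0 : 0 < th by rewrite !divr_gt0.
have th4 : th <= 1 / 4 by rewrite ler_pdivrMr//; lra.
pose b : R := d * th / 8.
have b0 : 0 < b by rewrite !divr_gt0// mulr_gt0.
pose c : R := b * th / 8.
have c0 : 0 < c by rewrite !divr_gt0// mulr_gt0.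
have cd : c <= d / 2.
  have := ler_wpM2l (ltW b0) th4; have := ler_wpM2l (ltW d0) th4.
  by rewrite /c /b; lra.
have [n1 hn1] := Pd' b b0.
have [n2 hn2] := Pd' c c0.
pose J := 'I_(maxn n1 n2).
have [D JD hD] := insens_inter_filled (enum T) J dhj b0.
pose H := (M + M * D)%type; pose nh : R := #|{: word H U}|%:R.
have nh0 : 0 < nh by rewrite ltr0n (word_gt0 _ None).
have [n3 hn3] := Pd' (c / nh) (divr_gt0 c0 nh0).
pose L := 'I_n3; have [A fA dA] := Pd (H + L)%type.
have secA v : d - c <= dens (fun y => A (cat v y)).
  rewrite -(divfK (lt0r_neq0 nh0) c); move: v; apply: avg_near_max.
  - move=> v; apply/ltW/hn3; first by rewrite card_ord.
    exact: (hereditary_fixl v (@linefree_hereditary U)).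
  - by rewrite -dens_catl.
  - by rewrite divr_ge0 ?ltW.
pose B w z y := variable w && [forall s, A (cat (rep s (insert_rows z w)) y)].
have lineB z : d / 4 <= \sum_w dens (B w z).
  pose f y := dens (fun v : word M T =>
    A (cat (insert_rows z [ffun i => Some (v i)]) y)) : R.
  have : d / 2 <= avg f.
    rewrite /f /dens exchange_avg -[leLHS](@avg_cst _ {: word M T} _ (word_gt0 _ t0)).
    by apply: ler_avg => v; rewrite (le_trans _ (secA _))//; lra.
  move=> /(avg_markov (fun y => dens_le1 _)) => /(_ ltac:(lra)).
  have -> : d / 2 / 2 = d / 4 by lra.
  move=> /le_trans; apply; rewrite -avg_sum; apply: ler_avg => y.
  have [ey|_] := leP (d / 4) (f y); last by rewrite sumr_ge0.
  have : ~ linefree (fun v : word M T =>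
      A (cat (insert_rows z [ffun i => Some (v i)]) y)).
    by move=> /hN0; rewrite card_ord ltNge [_ <= _]ey => /(_ (leqnn _)).
  move=> /existsNP[u /not_implyP[vu /contrapT uA]].
  rewrite (bigD1 u)//= {1}/B vu.
  have -> : [forall s, A (cat (rep s (insert_rows z u)) y)].
    by apply/forallP => s; rewrite -insert_rows_pt.
  by rewrite lerDl sumr_ge0.
have [w dw] : exists w, th <= avg (fun z => dens (B w z)).
  have [w hw] := avg_le_exists (fun w => avg (fun z => dens (B w z)) : R)
    (word_gt0 M (None : U)).
  exists w; rewrite (le_trans _ hw)// /avg ler_pM2r ?invr_gt0 ?(lt_le_trans ltr01)//.
  rewrite -avg_sum -[leLHS](@avg_cst _ {: word (M * D)%type U} _ (word_gt0 _ None)).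
  exact: ler_avg.
have /existsP[p /eqP wp] : variable w.
  apply: contraTT dw => /negPf nw; rewrite -ltNge (le_lt_trans (y := 0))//.
  rewrite /avg big1 ?mul0r// => z _.
  by rewrite /dens /avg big1 ?mul0r// => y _; rewrite /B nw.
move: dw; rewrite (avg_set_row p _ None) => dw.
have [z0 {}dw] : exists o, th <= avg (fun x => dens (B w (set_row p o x))).
  have [z0 hz0] := avg_le_exists (fun o => avg (fun x => dens (B w (set_row p o x))) : R)
    (word_gt0 (M * D)%type (None : U)).
  by exists z0; exact: le_trans hz0.
pose g0 (s : H) : U + D := match s with
  | inl k => inl (w k)
  | inr q => if q.1 == p then inr q.2
             else inl (if z0 q is Some a then Some a else w q.1)
  end.
have og0 : onto g0 by move=> k; exists (inr (p, k)); rewrite /g0 eqxx.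
have g0E x : sub g0 x = insert_rows (set_row p z0 x) w.
  apply/ffunP => -[k|[q k]]; rewrite !ffunE//=; case: eqP => // ->.
  by rewrite wp; case: (x k).
pose A' y x := A (cat (sub g0 x) y).
pose C y s x := A (cat (rep s (sub g0 x)) y).
pose bb y := dens (fun x => all (C y ^~ x) (enum T)) : R.
have bbth : th <= avg bb.
  rewrite (le_trans dw)// /bb /dens exchange_avg; apply: ler_avg => x.
  apply: le_dens => y /andP[_ /forallP h]; apply/allP => s _.
  by rewrite /C g0E.
have aad : d - c <= avg (fun y => dens (A' y)).
  rewrite /dens exchange_avg -[leLHS](@avg_cst _ {: word D U} _ (word_gt0 _ None)).
  by apply: ler_avg => x; exact: secA.
have fA' y : linefree (A' y).
  have := linefree_hereditary (onto_fixr y og0) fA.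
  by congr linefree; apply/funext => x; rewrite sub_fixr.
have aac y : dens (A' y) <= d + c.
  by apply/ltW/hn2 => //; rewrite (leq_trans _ JD)// card_ord leq_maxr.
have [y hy] := avg_le_exists (fun y => b * bb y - (d + c - dens (A' y)))
  (word_gt0 L (None : U)).
move: hy; rewrite 2!avgB avgZ avg_cst ?(word_gt0 _ None)// => hy.
have bb1 : bb y <= 1 := dens_le1 _.
have bby : th / 2 <= bb y.
  have : b * (th / 2) <= b * bb y by have := aac y; rewrite /c in aad hy *; nra.
  by rewrite ler_pM2l.
have aay : d - b <= dens (A' y).
  by rewrite /c in aad hy *; nra.
have disj x : A' y x -> ~~ all (C y ^~ x) (enum T).
  move=> Ax; apply/negP => /allP Cx.
  pose u : word (H + L)%type (option U) := [ffun s => match s with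
    | inl h => omap Some (sub g0 x h) | inr l => Some (y l) end].
  apply: (fA u).
    by apply/existsP; exists (inl (inl p)); rewrite !ffunE/= wp.
  case=> [s|].
    have := Cx s; rewrite mem_enum => /(_ isT); congr (is_true (A _)).
    by apply/ffunP => -[h|l]; rewrite !ffunE//; case: (g0 h) => [[]|k]//=; case: (x k).
  move: Ax; congr (is_true (A _)).
  by apply/ffunP => -[h|l]; rewrite !ffunE//; case: (g0 h) => [[]|k]//=; case: (x k).
have : avg (fun x => (~~ all (C y ^~ x) (enum T))%:R *
    ((A' y x)%:R - (d + b))) <= b.
  apply: (hD (C y)) => [s x|x|g og].
  - by rewrite /C rep_sub.
  - by case: (A' y x) => /=; lra.
  - rewrite avgB avg_cst ?(word_gt0 _ None)// subr_le0; apply/ltW/hn1.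
      by rewrite card_ord leq_maxl.
    exact: linefree_hereditary (fA' y).
have -> : avg (fun x => (~~ all (C y ^~ x) (enum T))%:R * ((A' y x)%:R - (d + b))) =
    dens (A' y) - (d + b) * (1 - bb y).
  rewrite -[X in X - bb y](avg_cst 1 (word_gt0 D (None : U))) -avgB -avgZ -avgB.
  apply: eq_avg => x; have := disj x.
  by case: (A' y x); case: all => //= h; by [lra | have := h isT].
by rewrite /b in b0 aay *; nra.
Qed.

End Step.

Lemma DHJ_bij (R : realType) (T T' : finType) (h : T -> T') : bijective h ->
  DHJ R T -> DHJ R T'.
Proof.
move=> hbij dhj e /dhj[N hN]; exists N => I NI A fA.
have [h' hK h'K] := hbij.
pose H (v : word I T) : word I T' := [ffun i => h (v i)].
have Hbij : bijective H.
  exists (fun v : word I T' => [ffun i => h' (v i)]) => v;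
  by apply/ffunP => i; rewrite !ffunE ?hK ?h'K.
rewrite /dens (reindex_avg _ Hbij); apply: hN => // w vw wA.
apply: (fA [ffun i => omap h (w i)]).
  by have /existsP[i /eqP wi] := vw; apply/existsP; exists i; rewrite ffunE wi.
move=> t'; rewrite -[t']h'K; have := wA (h' t'); congr (is_true (A _)).
by apply/ffunP => i; rewrite !ffunE; case: (w i).
Qed.

Theorem density_Hales_Jewett (R : realType) (T : finType) : (0 < #|T|)%N -> DHJ R T.
Proof.
have [n] := ubnP #|T|; case: n => // n; rewrite ltnS => Tn T0.
have {Tn T0} : exists n, #|T| = n.+1 by exists #|T|.-1; rewrite prednK.
case=> {}n; elim: n T => [|n IH] T cT.
  move=> e e0; exists 1%N => I I1 A fA.
  rewrite /dens /avg big1 ?mul0r// => x _; case Ax: (A x) => //.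
  exfalso; apply: (fA [ffun=> None]).
    by have [i _] := card_gt0P I1; apply/existsP; exists i; rewrite ffunE.
  move=> t; move: Ax; congr (is_true (A _)); apply/ffunP => i.
  by apply: (@card_le1_eqP _ predT); rewrite // -?cT.
have cI : #|{: option 'I_n.+1}| = #|T| by rewrite card_option card_ord cT.
apply: (@DHJ_bij _ (option 'I_n.+1) T (fun x => enum_val (cast_ord cI (enum_rank x)))).
  exists (fun x => enum_val (cast_ord (esym cI) (enum_rank x))) => x;
  by rewrite enum_valK ?cast_ordK ?cast_ordKV enum_rankK.
by apply: (DHJ_option ord0); apply: IH; rewrite card_ord.
Qed.

(** * Translations of the circle *)

Local Open Scope classical_set_scope.

Section Frac.
Context {R : realType}.
Implicit Types x y c : R.

Lemma frac_itv x : 0 <= frac x < 1.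
Proof.
have := floor_itv x; rewrite /frac intrD => /andP[? ?].
by apply/andP; split; lra.
Qed.

Lemma frac_id x : 0 <= x < 1 -> frac x = x.
Proof.
by move=> x01; rewrite /frac (@floor_def _ x 0) ?subr0// add0r.
Qed.

Lemma fracDz x (z : int) : frac (x + z%:~R) = frac x.
Proof.
rewrite /frac floorDrz ?intr_int// intrD intrKfloor; lra.
Qed.

Lemma fracDl x y : frac (frac x + y) = frac (x + y).
Proof. by rewrite /frac -/(frac _) addrAC -mulrNz -/(frac _) fracDz. Qed.

Lemma int_frac x : (x \is a Num.int) = (frac x == 0).
Proof.
rewrite /frac subr_eq0; apply/idP/eqP => [/floorK //|->].
exact: intr_int.
Qed.

Lemma measurable_frac : measurable_fun [set: R] (@frac R).
Proof.
apply: measurable_funB => //; apply: nondecreasing_measurable => // x y xy.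
by rewrite ler_int; apply: le_floor.
Qed.

Lemma lebesgue_measure_shift c (A : set R) : measurable A ->
  lebesgue_measure ((fun x => x + c) @^-1` A) = lebesgue_measure A.
Proof.
move=> mA; pose f := (fun x => x + c) : R -> measurableTypeR R.
have mf : measurable_fun setT f by apply: measurable_funD.
apply/esym; apply: (@lebesgue_measure_unique _ (pushforward lebesgue_measure f)) => //.
move=> _ [[a b]] _ <-; rewrite /pushforward/=.
rewrite [X in _ = lebesgue_measure X](_ : _ = `]a - c, b - c]%classic); last first.
  by apply/seteqP; split=> x; rewrite /f/= !in_itv/= ltrBlDr lerBrDr.
rewrite !lebesgue_measure_itv/= !lte_fin ltrD2r -!EFinD.
by case: ifP => // _; congr EFin; lra.
Qed.

Lemma lebesgue_measure_frac_shift c (A : set R) : measurable A -> A `<=` `[0, 1[ ->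
  lebesgue_measure (`[0, 1[ `&` (fun x => frac (x + c)) @^-1` A) =
  lebesgue_measure A.
Proof.
move=> mA A01.
have [f /andP[f0 f1] E] : exists2 f, 0 <= f < 1 &
    forall x, frac (x + c) = frac (x + f).
  exists (frac c); first exact: frac_itv.
  by move=> x; rewrite [in RHS]addrC fracDl addrC.
have -> : `[0, 1[ `&` (fun x => frac (x + c)) @^-1` A =
    ((fun x => x + f) @^-1` (A `&` `[f, 1[)) `|`
    ((fun x => x + (f - 1)) @^-1` (A `&` `[0, f[)).
  apply/seteqP; split=> x /=; rewrite !in_itv/= E.
    move=> [/andP[x0 x1]]; have [xf|xf] := ltP (x + f) 1.
      rewrite frac_id; last by apply/andP; split; lra.
      by move=> Ax; left; split => //; apply/andP; split; lra.
    have -> : x + f = x + (f - 1) + 1%:~R by lra.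
    rewrite fracDz frac_id; last by apply/andP; split; lra.
    move=> Ax; right; split => //; apply/andP; split; lra.
  case=> -[Ax /andP[h1 h2]].
    split; first by apply/andP; split; lra.
    by rewrite frac_id//; apply/andP; split; lra.
  split; first by apply/andP; split; lra.
  have -> : x + f = x + (f - 1) + 1%:~R by lra.
  by rewrite fracDz frac_id//; apply/andP; split; lra.
have m1 : measurable (A `&` `[f, 1[) by exact: measurableI.
have m2 : measurable (A `&` `[0, f[) by exact: measurableI.
have ms d B : measurable B -> measurable ((fun x => x + d) @^-1` B).
  by move=> mB; rewrite -[X in measurable X]setTI; apply: measurable_funD.
rewrite [in RHS](_ : A = (A `&` `[f, 1[) `|` (A `&` `[0, f[)); last first.
  rewrite -setIUr; apply/esym/setIidPl => x /A01.
  rewrite /= !in_itv/= => /andP[-> ->]; rewrite andbT.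
  by case: leP => ?; [left|right].
rewrite [LHS]measureU; [|exact: ms|exact: ms|].
  rewrite [RHS]measureU//.
    by congr (_ + _)%E; exact: lebesgue_measure_shift.
  apply/seteqP; split=> // x /= [[_ +] [_ +]].
  by rewrite !in_itv/= => /andP[? ?] /andP[? ?]; lra.
apply/seteqP; split=> // x /= [[_ +] [_ +]].
by rewrite !in_itv/= => /andP[? ?] /andP[? ?]; lra.
Qed.

End Frac.

(** * Random words *)

Section ProductMeasure.
Context d1 d2 (T1 : measurableType d1) (T2 : measurableType d2) (R : realType).
Variables (P1 : probability T1 R) (P2 : probability T2 R).
Local Open Scope ereal_scope.

Lemma product_measure_xsection_cst (K : set T1) B c : measurable K -> P1 K = 1 ->
  measurable B -> 0 <= c -> (forall x, K x -> P2 (xsection B x) = c) ->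
  (P1 \x P2) B = c.
Proof.
move=> mK K1 mB c0 hB; rewrite /product_measure1.
transitivity (\int[P1]_x cst c x).
  apply: ge0_ae_eq_integral => //.
    exact: measurable_fun_xsection.
  exists (~` K); split; first exact: measurableC.
    by rewrite [LHS](probability_setC P1 mK) K1 subee.
  by move=> x /= h Kx; apply: h => _; exact: hB.
by rewrite integral_cst// [X in _ * X](probability_setT P1) mule1.
Qed.

Lemma product_measure_ysection_cst B c :
  measurable B -> 0 <= c -> (forall y, P1 (ysection B y) = c) ->
  (P1 \x P2) B = c.
Proof.
move=> mB c0 hB.
transitivity (\int[P1]_x fubini_F P2 (EFin \o \1_B) x).
  by rewrite indic_fubini_tonelli_FE.
rewrite (indic_fubini_tonelli P1 P2 mB) indic_fubini_tonelli_GE//.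
transitivity (\int[P2]_y cst c y); first by apply: eq_integral => y _; exact: hB.
by rewrite integral_cst// [X in _ * X](probability_setT P2) mule1.
Qed.

End ProductMeasure.

Section UniformMeasure.
Context {R : realType}.

Definition unif01 : set (measurableTypeR R) -> \bar R :=
  mrestr (@lebesgue_measure R) (measurable_itv (Interval (BLeft 0) (BLeft 1))).

HB.instance Definition _ := Measure.on unif01.

Let unif01_setT : unif01 setT = 1%E.
Proof.
by rewrite /unif01 /mrestr setTI lebesgue_measure_itv/= lte_fin ltr01 oppr0 adde0.
Qed.

HB.instance Definition _ := Measure_isProbability.Build _ _ _ unif01 unif01_setT.

End UniformMeasure.

Lemma measurable_forall d (T : measurableType d) (I : finType) (F : I -> set T) :
  (forall i, measurable (F i)) -> measurable [set x | forall i, F i x].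
Proof.
move=> mF; rewrite (_ : [set x | _] = \bigcap_(i in [set: I]) F i).
  by apply: fin_bigcap_measurable => //; exact: finite_finset.
by apply/seteqP; split=> x /= h i; [move=> _|]; exact: h.
Qed.

Section Kernel.
Context {R : realType} {r m : nat} (L : 'M[int]_(r, m)).

Lemma measurable_kerT : measurable (@kerT R r m L).
Proof.
rewrite (_ : kerT L =
  [set x : m.-tuple R | forall j, [set y | 0 <= tnth y j < 1] x] `&`
  [set x : m.-tuple R | forall i,
     [set y | frac (\sum_(j < m) (L i j)%:~R * tnth y j) = 0] x]); last first.
  apply/seteqP; split=> x /= [h1 h2]; split=> // i.
    by apply/eqP; rewrite -int_frac.
  by rewrite int_frac h2.
apply: measurableI; apply: measurable_forall => i.
  rewrite (_ : [set y | _] = (fun y : m.-tuple R => tnth y i) @^-1` `[0, 1[).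
    by rewrite -[X in measurable X]setTI; apply: measurable_tnth.
  by apply/seteqP; split=> x /=; rewrite in_itv.
rewrite (_ : [set y | _] = (fun y : m.-tuple R =>
  frac (\sum_(j < m) (L i j)%:~R * tnth y j)) @^-1` [set 0])//.
rewrite -[X in measurable X]setTI.
have : measurable_fun [set: m.-tuple R]
    (fun y => frac (\sum_(j < m) (L i j)%:~R * tnth y j)).
  apply: (measurableT_comp measurable_frac).
  apply: measurable_sum => j; apply: measurable_funM => //.
  exact: measurable_tnth.
exact.
Qed.

Lemma kerT_cst (c : R) : invariant_mx L -> 0 <= c < 1 ->
  kerT L [tuple c | i < m].
Proof.
move=> iL c01; split=> i; first by rewrite tnth_mktuple.
under eq_bigr do rewrite tnth_mktuple.
by rewrite -mulr_suml -rmorph_sum iL mul0r int_num0.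
Qed.

Lemma measurable_addT (t : m.-tuple R) :
  measurable_fun [set: m.-tuple R] (addT ^~ t).
Proof.
apply/measurable_fun_tnthP => i.
rewrite (_ : _ \o _ = fun x : m.-tuple R => frac (tnth x i + tnth t i)).
  apply: (measurableT_comp measurable_frac); apply: measurable_funD => //.
  exact: measurable_tnth.
by apply/funext => x /=; rewrite tnth_mktuple.
Qed.

End Kernel.

Fixpoint idx (n : nat) : finType := if n is k.+1 then option (idx k) else void.

Lemma card_idx n : #|idx n| = n.
Proof. by elim: n => [|n IH]; [exact: card_void|rewrite card_option IH]. Qed.

Section RandomWords.
Context {R : realType} {m : nat}.

Definition line_tuple (I : finType) (Omega : Type) (X : word I 'I_m -> Omega -> R)
    (w : word I (option 'I_m)) (o : Omega) : m.-tuple R :=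
  [tuple X (pt w i) o | i < m].

Lemma measurable_line_tuple (I : finType) d (Omega : measurableType d)
    (X : word I 'I_m -> Omega -> R) w :
  (forall u, measurable_fun setT (X u)) -> measurable_fun setT (line_tuple X w).
Proof.
move=> mX; apply/measurable_fun_tnthP => i.
rewrite (_ : _ \o _ = X (pt w i))//.
by apply/funext => x /=; rewrite tnth_mktuple.
Qed.

(* [X u = frac (x + \sum_s y_s (u s))] with [x] uniform in [0, 1[ and the [y_s]
   independent with law [mu], all independent.  On a combinatorial line, the
   points at the variable positions form a [mu]-distributed tuple, and
   everything else translates it by an element of the kernel. *)
Lemma random_words r (L : 'M[int]_(r, m)) (mu : probability (m.-tuple R) R)
    (n : nat) : (0 < m)%N -> invariant_mx L -> is_haar_kerT L mu ->
  exists d (Omega : measurableType d) (P : probability Omega R)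
      (X : word (idx n) 'I_m -> Omega -> R),
    [/\ forall u, measurable_fun setT (X u),
        forall u o, 0 <= X u o < 1,
        forall u (A : set R), measurable A -> A `<=` `[0, 1[ ->
          P (X u @^-1` A) = lebesgue_measure A
      & forall w B, variable w -> measurable B -> P (line_tuple X w @^-1` B) = mu B].
Proof.
move=> m0 iL [muK muT]; elim: n => [|n [d [ Omega [P [X [mX X01 XA XB]]]]]].
  exists _, _, (@unif01 R), (fun _ => @frac R); split=> [_|_ o|_ A mA A01|w B].
  - exact: measurable_frac.
  - exact: frac_itv.
  - rewrite /= /unif01 /mrestr; congr lebesgue_measure.
    apply/seteqP; split=> x /=; rewrite in_itv/=.
      by move=> [+ x01]; rewrite frac_id.
    move=> Ax; have := A01 _ Ax; rewrite /= in_itv/= => x01; split=> //.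
    by rewrite frac_id.
  - by move=> /existsP[[]].
pose res (T : finType) (u : word (idx n.+1) T) : word (idx n) T :=
  [ffun i => u (Some i)].
pose X' u (p : m.-tuple R * Omega) : R := frac (X (res _ u) p.2 + tnth p.1 (u None)).
have mX' u : measurable_fun setT (X' u).
  apply: (measurableT_comp measurable_frac); apply: measurable_funD.
    exact: measurableT_comp.
  by apply: measurableT_comp (measurable_tnth _) _.
have res_pt w i : res _ (pt w i) = pt (res _ w) i.
  by apply/ffunP => k; rewrite !ffunE.
exists _, _, (mu \x P)%E, X'; split => // [u o|u A mA A01|w B vw mB].
- exact: frac_itv.
- apply: (product_measure_xsection_cst (K := setT)) => //.
  + exact: probability_setT.
  + by rewrite -[X in measurable X]setTI; exact: mX'.
  + move=> y _; set c := tnth y (u None).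
    rewrite -(lebesgue_measure_frac_shift c mA A01) -(XA (res _ u)); last 2 first.
    * apply: measurableI => //; rewrite -[X in measurable X]setTI.
      apply: (measurableT_comp measurable_frac) => //.
      exact: measurable_funD.
    * by move=> x [].
    congr (P _); apply/seteqP; split=> o; rewrite /xsection/= inE/= in_itv/=.
      by move=> ?; split=> //; exact: X01.
    by case.
- have mZB : measurable (line_tuple X' w @^-1` B).
    by rewrite -[X in measurable X]setTI; exact: measurable_line_tuple.
  have [vres|nvres] := boolP (variable (res _ w)).
  + apply: (product_measure_xsection_cst (K := kerT L)) => //.
      exact: measurable_kerT.
    move=> y Ky; pose t := [tuple tnth y (odflt i (w None)) | i < m].
    have Kt : kerT L t.
      rewrite /t; case: (w None) => [j|] /=; first by apply: kerT_cst => //; apply: Ky.1.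
      by rewrite (_ : [tuple _ | _ < _] = y)//; apply: eq_from_tnth => i;
        rewrite tnth_mktuple.
    rewrite -(muT t Kt B mB) -(XB (res _ w))//; last first.
      by rewrite -[X in measurable X]setTI; exact: measurable_addT.
    suff E o : line_tuple X' w (y, o) = addT (line_tuple X (res _ w) o) t.
      by congr (P _); apply/seteqP; split=> o; rewrite /xsection/= inE/= E.
    by apply: eq_from_tnth => i; rewrite !tnth_mktuple /X'/= res_pt ffunE.
  + have w0 : w None = None.
      have /existsP[[i|] /eqP//] := vw.
      move=> wi; case/negP: nvres; apply/existsP; exists i.
      by rewrite ffunE wi.
    apply: product_measure_ysection_cst => // o.
    pose c := X (pt (res _ w) (Ordinal m0)) o.
    rewrite -(muT [tuple c | i < m] _ B mB); last exact: (kerT_cst iL (X01 _ _)).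
    suff E y : line_tuple X' w (y, o) = addT y [tuple c | i < m].
      by congr (mu _); apply/seteqP; split=> y; rewrite /ysection/= inE/= E.
    apply: eq_from_tnth => i.
    rewrite !tnth_mktuple /X'/= res_pt ffunE w0/= addrC /c; congr (frac (_ + X _ _)).
    apply/ffunP => k; rewrite !ffunE; case wk : (w (Some k)) => //.
    by case/negP: nvres; apply/existsP; exists k; rewrite ffunE wk.
Qed.

End RandomWords.

Section WeightedEvents.
Context d (Omega : measurableType d) {R : realType} (P : probability Omega R).
Local Open Scope ereal_scope.

Lemma integral_weighted_indic (J : finType) (c : J -> R) (F : J -> set Omega) :
  (forall j, (0 <= c j)%R) -> (forall j, measurable (F j)) ->
  \int[P]_o (\sum_j (c j * \1_(F j) o)%:E) = \sum_j (c j)%:E * P (F j).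
Proof.
move=> c0 mF; have m1 j : measurable_fun setT (fun o => (\1_(F j) o)%:E : \bar R).
  exact/measurable_EFinP/measurable_indic.
rewrite ge0_integral_sum//; last 2 first.
  by move=> j; apply/measurable_EFinP/measurable_funM => //; exact/measurable_EFinP.
  by move=> j o _; rewrite lee_fin mulr_ge0.
apply: eq_bigr => j _; under eq_integral do rewrite EFinM.
rewrite ge0_integralZl_EFin//.
by rewrite integral_indic// setIT.
Qed.

Lemma le_weighted_measure (J K : finType) (c : J -> R) (F : J -> set Omega)
    (e : K -> R) (G : K -> set Omega) :
  (forall j, (0 <= c j)%R) -> (forall j, measurable (F j)) ->
  (forall k, (0 <= e k)%R) -> (forall k, measurable (G k)) ->
  (forall o, (\sum_j c j * \1_(F j) o <= \sum_k e k * \1_(G k) o)%R) ->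
  \sum_j (c j)%:E * P (F j) <= \sum_k (e k)%:E * P (G k).
Proof.
move=> c0 mF e0 mG FG; rewrite -!integral_weighted_indic//.
have mS (J' : finType) (c' : J' -> R) (F' : J' -> set Omega) :
    (forall j, measurable (F' j)) ->
    measurable_fun setT (fun o => \sum_j (c' j * \1_(F' j) o)%:E).
  move=> mF'; apply: emeasurable_sum => j.
  by apply/measurable_EFinP/measurable_funM => //; exact/measurable_EFinP.
apply: ge0_le_integral => //; [|exact: mS|exact: mS|].
  by move=> o _; apply: sume_ge0 => j _; rewrite lee_fin mulr_ge0.
by move=> o _; rewrite !sumEFin lee_fin.
Qed.

End WeightedEvents.

Theorem theorem1p4 (R : realType) (r m : nat) (L : 'M[int]_(r, m)) :
  invariant_mx L ->
  \rank (int_mx_to_rat L) = r ->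
  forall alpha : R, 0 < alpha ->
  exists c : R, 0 < c /\
    forall mu : probability (m.-tuple R) R, is_haar_kerT L mu ->
    forall A : set R, measurable A -> A `<=` `[0, 1[ ->
      (alpha%:E <= (@lebesgue_measure R) A)%E ->
      (c%:E <= S_L L mu A)%E.
Proof.
move=> iL _ alpha alpha0; have [m0|m0] := posnP m.
  subst m; exists 1; split=> // mu [muK _] A mA A01 _.
  rewrite /S_L -muK (_ : _ `&` _ = kerT L)//.
  by apply/setIidPr => x _ [].
have a20 : 0 < alpha / 2 by rewrite divr_gt0.
have [|N hN] := @density_Hales_Jewett R 'I_m _ (alpha / 2) a20.
  by rewrite card_ord.
pose W := {: word (idx N) 'I_m}; pose V := {: word (idx N) (option 'I_m)}.
have W0 : 0 < #|W|%:R :> R by rewrite ltr0n (word_gt0 _ (Ordinal m0)).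
have V0 : 0 < #|V|%:R :> R by rewrite ltr0n (word_gt0 _ None).
exists (alpha / 2 / #|V|%:R); split; first by rewrite divr_gt0.
move=> mu hmu A mA A01 alphaA.
have [d [ Omega [P [X [mX X01 XA XB]]]]] := random_words N m0 iL hmu.
pose B := [set x : m.-tuple R | forall i, A (tnth x i)].
have mB : measurable B.
  apply: (measurable_forall (F := fun i x => A (tnth x i))) => i.
  by rewrite -[X in measurable X]setTI; apply: measurable_tnth.
have mK := @measurable_kerT R r m L.
have muB : S_L L mu A = mu B.
  rewrite /S_L -/B [RHS](measureDI mu mB mK) [X in (X + _)%E](_ : _ = 0%E) ?add0e//.
  apply: (@subset_measure0 _ _ _ mu _ (~` kerT L)) => //.
  - exact: measurableD.
  - exact: measurableC.
  - by case: hmu => muK _; rewrite [LHS](probability_setC mu mK) muK subee.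
pose s := fine (mu B).
have mus : mu B = s%:E by rewrite fineK// fin_num_measure.
have s0 : 0 <= s by rewrite fine_ge0.
rewrite muB mus lee_fin.
pose A' u := X u @^-1` A.
have mA' u : measurable (A' u).
  by rewrite -[X in measurable X]setTI; exact: mX.
pose e (k : 'I_1 + V) : R :=
  match k with inl _ => alpha / 2 | inr w => (variable w)%:R end.
pose G (k : 'I_1 + V) : set Omega :=
  match k with inl _ => setT | inr w => line_tuple X w @^-1` B end.
have mG k : measurable (G k).
  case: k => [k|w] //=; rewrite -[X in measurable X]setTI.
  exact: measurable_line_tuple.
have e0 k : 0 <= e k by case: k => [k|w] /=; rewrite ?ler0n ?ltW.
have : (\sum_(u : W) (#|W|%:R^-1)%:E * P (A' u) <=
    \sum_(k : 'I_1 + V) (e k)%:E * P (G k))%E.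
  apply: le_weighted_measure => // o.
  rewrite big_sumType /= big_ord1 indicT mulr1.
  have -> : \sum_(u : W) #|W|%:R^-1 * \1_(A' u) o =
      dens (fun u => `[< A (X u o) >]) :> R.
    by rewrite -mulr_sumr mulrC.
  have [lf|] := pselect (linefree (fun u => `[< A (X u o) >])).
    rewrite (le_trans (ltW (hN _ _ _ lf))) ?card_idx// lerDl.
    by rewrite sumr_ge0// => w _; rewrite mulr_ge0.
  move=> /existsNP[w /not_implyP[vw /contrapT wA]].
  rewrite (le_trans (dens_le1 _))// (bigD1 w)//= vw mul1r indicE mem_set; last first.
    by move=> i /=; rewrite tnth_mktuple; apply/asboolP.
  rewrite addrCA lerDl addr_ge0//; first exact: ltW.
  by rewrite sumr_ge0// => v _; rewrite mulr_ge0.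
rewrite big_sumType /= big_ord1 probability_setT mule1.
have [l lE] : exists l, lebesgue_measure A = l%:E.
  exists (fine (P (A' [ffun=> Ordinal m0]))).
  by rewrite fineK ?fin_num_measure// [RHS]XA.
have -> : (\sum_(u : W) (#|W|%:R^-1)%:E * P (A' u) = l%:E)%E.
  under eq_bigr do rewrite [P _]XA// lE -EFinM.
  by rewrite sumEFin sum_cst mulVKf// gt_eqF.
have -> : (\sum_(w : V) ((variable w)%:R)%:E * P (line_tuple X w @^-1` B) =
    (\sum_(w : V) (variable w)%:R * s)%:E)%E.
  rewrite -sumEFin; apply: eq_bigr => w _; case: (boolP (variable w)) => vw.
    by rewrite [P _]XB// mus EFinM.
  by rewrite mul0e mul0r.
move: alphaA; rewrite lE -EFinD !lee_fin => alphal le_l.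
rewrite ler_pdivrMr// mulrC.
have : \sum_(w : V) (variable w)%:R * s <= #|V|%:R * s.
  by rewrite -sum_cst; apply: ler_sum => w _; case: variable; rewrite ?mul1r ?mul0r.
lra.
Qed.
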